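(* Let $\mathbf{x}_1,\dots,\mathbf{x}_N\in\mathbb{R}^K$ be nonzero, let $\mathbf{T}$ be a real symmetric positive definite $K\times K$ matrix, and let $\alpha_0>0$. If the equation $$\boldsymbol{\Sigma}=\frac{1}{1+\alpha_0}\frac KN\sum_{i=1}^N\frac{\mathbf{x}_i\mathbf{x}_i^T}{\mathbf{x}_i^T\boldsymbol{\Sigma}^{-1}\mathbf{x}_i}+\frac{\alpha_0}{1+\alpha_0}\mathbf{T}$$ has a solution $\boldsymbol{\Sigma}$ among the real symmetric positive definite $K\times K$ matrices, then this solution is unique. *)

(* Defs.v *)
From mathcomp Require Import all_boot all_order all_algebra.
From mathcomp Require Import reals.

Set Implicit Arguments.
Unset Strict Implicit.
Unset Printing Implicit Defensive.

Import Order.TTheory GRing.Theory Num.Theory.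
Local Open Scope ring_scope.

Definition quadform (R : realType) (K : nat) (A : 'M[R]_K) (v : 'cV[R]_K) : R :=
  (v^T *m A *m v) 0 0.

Definition sym_posdef (R : realType) (K : nat) (A : 'M[R]_K) : Prop :=
  A \is symmetricmx /\ forall v : 'cV[R]_K, v != 0 -> 0 < quadform A v.

(* A positive definite S is invertible, so invmx S is its genuine inverse and,
   for x i != 0, the denominators below are nonzero. *)
Definition solves_fixed_point (R : realType) (K N : nat) (x : 'I_N -> 'cV[R]_K)
    (T : 'M[R]_K) (alpha0 : R) (S : 'M[R]_K) : Prop :=
  S = (1 / (1 + alpha0) * (K%:R / N%:R)) *:
        (\sum_(i < N) (quadform (invmx S) (x i))^-1 *: (x i *m (x i)^T))
      + (alpha0 / (1 + alpha0)) *: T.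

(* Main.v *)
Require Import Defs.
From mathcomp Require Import all_boot all_order all_algebra.
From mathcomp Require Import reals.
From mathcomp Require Import classical_sets ring lra.

Set Implicit Arguments.
Unset Strict Implicit.
Unset Printing Implicit Defensive.

Import Order.TTheory GRing.Theory Num.Theory.
Local Open Scope ring_scope.

(* A solution S1 dominated by l S2 (l >= 1) is dominated by l' S2 with l' - 1 a
   fixed fraction of l - 1: inversion is antitone, so the sum on the right-hand
   side grows by a factor of at most l, while the T term does not grow at all.
   Hence the infimum of all such l is 1, i.e. S1 <= S2. By symmetry the quadratic
   forms of S1 and S2, and thus those of their inverses, agree, and the equation
   itself gives S1 = S2. *)

Lemma quadform0 (R : realType) (K : nat) (A : 'M[R]_K) : quadform A 0 = 0.
Proof. by rewrite /quadform mulmx0 mxE. Qed.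

Lemma quadformD (R : realType) (K : nat) (A B : 'M[R]_K) (v : 'cV[R]_K) :
  quadform (A + B) v = quadform A v + quadform B v.
Proof. by rewrite /quadform mulmxDr mulmxDl mxE. Qed.

Lemma quadformZ (R : realType) (K : nat) (a : R) (A : 'M[R]_K) (v : 'cV[R]_K) :
  quadform (a *: A) v = a * quadform A v.
Proof. by rewrite /quadform -scalemxAr -scalemxAl mxE. Qed.

Lemma quadform_sum (R : realType) (K N : nat) (A : 'I_N -> 'M[R]_K)
    (v : 'cV[R]_K) :
  quadform (\sum_(i < N) A i) v = \sum_(i < N) quadform (A i) v.
Proof. by rewrite /quadform mulmx_sumr mulmx_suml summxE. Qed.

Lemma trmx_mul00 (R : realType) (K : nat) (u v : 'cV[R]_K) :
  (u^T *m v) 0 0 = (v^T *m u) 0 0.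
Proof. by rewrite -[u in RHS]trmxK -trmx_mul [RHS]mxE. Qed.

Lemma quadform_outer (R : realType) (K : nat) (u v : 'cV[R]_K) :
  quadform (u *m u^T) v = ((v^T *m u) 0 0) ^+ 2.
Proof.
by rewrite /quadform mulmxA -mulmxA mxE big_ord1 expr2 [X in _ * X]trmx_mul00.
Qed.

Lemma quadform_ge0 (R : realType) (K : nat) (A : 'M[R]_K) (v : 'cV[R]_K) :
  sym_posdef A -> 0 <= quadform A v.
Proof.
by move=> [_ Apos]; have [->|/Apos/ltW//] := eqVneq v 0; rewrite quadform0.
Qed.

Lemma sym_posdef_tr (R : realType) (K : nat) (A : 'M[R]_K) :
  sym_posdef A -> A^T = A.
Proof. by case=> /is_hermitianmxP; rewrite expr0 scale1r map_mx_id. Qed.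

Lemma sym_posdef_unit (R : realType) (K : nat) (A : 'M[R]_K) :
  sym_posdef A -> A \in unitmx.
Proof.
move=> [_ Apos]; rewrite unitmxE unitfE; apply/negP => /det0P[v v0 vA].
have /Apos : v^T != 0 by rewrite trmx_eq0.
by rewrite /quadform trmxK vA mul0mx mxE ltxx.
Qed.

Lemma quadform_inv (R : realType) (K : nat) (A : 'M[R]_K) (v : 'cV[R]_K) :
  sym_posdef A -> quadform (invmx A) v = quadform A (invmx A *m v).
Proof.
move=> PA; rewrite /quadform trmx_mul trmx_inv (sym_posdef_tr PA).
by rewrite -!mulmxA mulKVmx // sym_posdef_unit.
Qed.

Lemma quadform_inv_gt0 (R : realType) (K : nat) (A : 'M[R]_K) (v : 'cV[R]_K) :
  sym_posdef A -> v != 0 -> 0 < quadform (invmx A) v.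
Proof.
move=> PA v0; rewrite quadform_inv //; apply: PA.2.
apply: contra v0 => /eqP Av0.
by rewrite -(mulKVmx (sym_posdef_unit PA) v) Av0 mulmx0.
Qed.

Lemma quadform_lincomb (R : realType) (K : nat) (A : 'M[R]_K) (y z : 'cV[R]_K)
    (a b : R) : sym_posdef A ->
  quadform A (a *: y + b *: z) = a ^+ 2 * quadform A y
    + 2 * a * b * (y^T *m (A *m z)) 0 0 + b ^+ 2 * quadform A z.
Proof.
move=> PA.
have zAy : (z^T *m A *m y) 0 0 = (y^T *m (A *m z)) 0 0.
  by rewrite trmx_mul00 trmx_mul (sym_posdef_tr PA).
have tr : (a *: y + b *: z)^T = a *: y^T + b *: z^T by rewrite linearD /= !linearZ.
rewrite /quadform tr !mulmxDl !mulmxDr -!scalemxAl -!scalemxAr.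
rewrite mulmxA in zAy *.
(* Abstracting the four 1x1 products turns the goal into a scalar identity; [e] merges the two cross
   terms. *)
move: (y^T *m A *m y) (z^T *m A *m y) (z^T *m A *m z) (y^T *m A *m z) zAy.
by move=> p q r s e; rewrite !mxE e; ring.
Qed.

(* Cauchy-Schwarz for the form [A], applied to [y] and [invmx A *m x]. *)
Lemma dot_sqr_le (R : realType) (K : nat) (A : 'M[R]_K) (x y : 'cV[R]_K) :
  sym_posdef A ->
  ((y^T *m x) 0 0) ^+ 2 <= quadform A y * quadform (invmx A) x.
Proof.
move=> PA; have [->|x0] := eqVneq x 0.
  by rewrite quadform0 mulmx0 mxE expr0n mulr0.
have q0 := quadform_inv_gt0 PA x0.
set q := quadform (invmx A) x in q0 *; set s := (y^T *m x) 0 0.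
(* This vector is [q] times the component of [y] that is [A]-orthogonal to [invmx A *m x], scaled to
   avoid division. *)
have := quadform_ge0 (q *: y + (- s) *: (invmx A *m x)) PA.
rewrite quadform_lincomb // -quadform_inv // -/q mulKVmx ?sym_posdef_unit // -/s.
have -> : q ^+ 2 * quadform A y + 2 * q * (- s) * s + (- s) ^+ 2 * q
   = q * (quadform A y * q - s ^+ 2) by ring.
by rewrite pmulr_rge0 // subr_ge0.
Qed.

(** With [w = invmx B *m x] and [q = quadform B w = quadform (invmx B) x], Cauchy-Schwarz for [A]
    gives [q ^+ 2 <= quadform A w * quadform (invmx A) x]. The hypothesis at [w] bounds the first
    factor by [l * q], and one [q] cancels. No square root or diagonalization of a matrix is
    involved. *)
Lemma quadform_inv_antitone (R : realType) (K : nat) (A B : 'M[R]_K) (l : R) :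
  sym_posdef A -> sym_posdef B ->
  (forall v, quadform A v <= l * quadform B v) ->
  forall x, quadform (invmx B) x <= l * quadform (invmx A) x.
Proof.
move=> PA PB AB x; have [->|x0] := eqVneq x 0; first by rewrite !quadform0 mulr0.
have p0 := quadform_inv_gt0 PA x0; have q0 := quadform_inv_gt0 PB x0.
have := dot_sqr_le x (invmx B *m x) PA.
have -> : ((invmx B *m x)^T *m x) 0 0 = quadform (invmx B) x.
  by rewrite trmx_mul trmx_inv (sym_posdef_tr PB).
move=> /le_trans/(_ (ler_wpM2r (ltW p0) (AB _))).
by rewrite -quadform_inv // mulrAC expr2 ler_pM2r.
Qed.

(* Cauchy-Schwarz against the basis vectors bounds each [v i 0 ^+ 2] by
   [\tr (invmx B) * quadform B v], so no compactness is needed. *)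
Lemma quadform_dominated (R : realType) (K : nat) (A B : 'M[R]_K) :
  sym_posdef B ->
  exists2 M : R, 1 <= M & forall v, quadform A v <= M * quadform B v.
Proof.
move=> PB.
pose c i := quadform (invmx B) (delta_mx i 0).
have c0 i : 0 <= c i by rewrite /c quadform_inv // quadform_ge0.
pose C := \sum_i c i.
have vC (v : 'cV[R]_K) i : (v i 0) ^+ 2 <= C * quadform B v.
  have -> : v i 0 = (v^T *m (delta_mx i 0 : 'cV_K)) 0 0 by rewrite -colE !mxE.
  apply: le_trans (dot_sqr_le _ v PB) _.
  rewrite mulrC ler_wpM2r ?quadform_ge0 // /C (bigD1 i) //= lerDl.
  exact: sumr_ge0.
(* The double sum alone dominates; the summand 1 secures [1 <= M]. *)
exists (1 + \sum_i \sum_j `|A i j| * C).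
  by rewrite lerDl !sumr_ge0 // => i _; rewrite sumr_ge0 // => j _;
     rewrite mulr_ge0 // sumr_ge0.
move=> v; rewrite mulrDl mul1r -[leLHS]add0r lerD ?quadform_ge0 //.
have -> : quadform A v = \sum_i \sum_j A i j * (v i 0 * v j 0).
  rewrite /quadform -mulmxA mxE; apply: eq_bigr => i _.
  rewrite !mxE mulr_sumr; apply: eq_bigr => j _; ring.
rewrite mulr_suml ler_sum // => i _; rewrite mulr_suml ler_sum // => j _.
apply: le_trans (ler_norm _) _; rewrite normrM -mulrA ler_wpM2l //.
(* Both squares are at most [C * quadform B v], hence so is [v i 0 * v j 0] in absolute value, by
   the arithmetic-geometric mean inequality. *)
have vi := vC v i; have vj := vC v j.
by rewrite ler_norml; nra.
Qed.

(** Scaling the equation for [S2] by [l] scales its [T] term too, whereas [S1] contains that term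
    only once. The subtracted multiple of [quadform T v] is exactly this surplus. *)
Lemma fixed_point_contract (R : realType) (K N : nat) (x : 'I_N -> 'cV[R]_K)
    (T : 'M[R]_K) (alpha0 : R) (S1 S2 : 'M[R]_K) (l : R) :
  (forall i, x i != 0) -> 0 < alpha0 ->
  sym_posdef S1 -> sym_posdef S2 ->
  solves_fixed_point x T alpha0 S1 -> solves_fixed_point x T alpha0 S2 ->
  0 < l -> (forall v, quadform S1 v <= l * quadform S2 v) ->
  forall v, quadform S1 v <=
    l * quadform S2 v - (l - 1) * (alpha0 / (1 + alpha0)) * quadform T v.
Proof.
move=> x0 a0 P1 P2 E1 E2 l0 H v; have Hinv := quadform_inv_antitone P1 P2 H.
rewrite [in leLHS]E1 [in leRHS]E2 !quadformD !quadformZ !quadform_sum.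
set b := alpha0 / _; set c := 1 / _ * _.
have c0 : 0 <= c.
  by rewrite /c mulr_ge0 ?divr_ge0 ?ler0n // ltW // ltr_wpDl.
suff /(ler_wpM2l c0) : \sum_i quadform ((quadform (invmx S1) (x i))^-1 *: (x i *m (x i)^T)) v
   <= l * \sum_i quadform ((quadform (invmx S2) (x i))^-1 *: (x i *m (x i)^T)) v.
  set s1 := \sum_i _; set s2 := \sum_i _; lra.
rewrite mulr_sumr ler_sum // => i _.
rewrite !quadformZ quadform_outer mulrA ler_wpM2r ?sqr_ge0 //.
have p0 := quadform_inv_gt0 P1 (x0 i).
have q0 := quadform_inv_gt0 P2 (x0 i).
(* After clearing positive denominators this is [Hinv] at [x i]. *)
by rewrite -ler_pdivrMl // -invfM lef_pV2 ?posrE ?mulr_gt0.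
Qed.

Lemma fixed_point_le (R : realType) (K N : nat) (x : 'I_N -> 'cV[R]_K)
    (T : 'M[R]_K) (alpha0 : R) (S1 S2 : 'M[R]_K) :
  (forall i, x i != 0) -> sym_posdef T -> 0 < alpha0 ->
  sym_posdef S1 -> sym_posdef S2 ->
  solves_fixed_point x T alpha0 S1 -> solves_fixed_point x T alpha0 S2 ->
  forall v, quadform S1 v <= quadform S2 v.
Proof.
move=> x0 PT a0 P1 P2 E1 E2.
pose E : set R := [set l | 1 <= l /\ forall v, quadform S1 v <= l * quadform S2 v]%classic.
have E0 : (E !=set0)%classic by have [M M1 HM] := quadform_dominated S1 P2; exists M.
have lbE : lbound E 1 by move=> l [].
set m := inf E.
have m1 : 1 <= m by exact: lb_le_inf.
(* The infimum is attained: for each nonzero [v], the ratio of the two forms is a lower bound of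
   [E]. *)
have Hm v : quadform S1 v <= m * quadform S2 v.
  have [->|/P2.2 v0] := eqVneq v 0; first by rewrite !quadform0 mulr0.
  rewrite -ler_pdivrMr //; apply: lb_le_inf => // l [_ /(_ v)].
  by rewrite ler_pdivrMr.
(* Bounding [S2] by [M] times [T] converts the gain in [T] into a gain of [(m - 1) * (b / M)] in the
   factor of [S2]. *)
have [M M1 HM] := quadform_dominated S2 PT.
pose b := alpha0 / (1 + alpha0).
have a1 : 0 < 1 + alpha0 by rewrite addr_gt0.
have b0 : 0 < b by rewrite divr_gt0.
have M0 : 0 < M by exact: lt_le_trans M1.
have bM1 : b / M <= 1.
  by rewrite ler_pdivrMr // mul1r (le_trans _ M1) // ler_pdivrMr // mul1r lerDr.
have bM0 : 0 < b / M by rewrite divr_gt0.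
(* The improved factor lies in [E]; it stays at least 1 because [b / M <= 1]. Minimality of [m] then
   forces [m <= 1]. *)
have : m <= m - (m - 1) * (b / M).
  apply: ge_inf; first by exists 1.
  split=> [|v]; first by nra.
  apply: le_trans (fixed_point_contract x0 a0 P1 P2 E1 E2 _ Hm v) _; first exact: lt_le_trans m1.
  rewrite [leRHS]mulrBl lerD2l lerN2 -/b.
  rewrite (mulrA (m - 1)) -[leLHS]mulrA ler_wpM2l //.
    by apply: mulr_ge0; [rewrite subr_ge0 | exact: ltW].
  by rewrite ler_pdivrMl.
rewrite lerDl oppr_ge0 pmulr_lle0 // subr_le0 => m1'.
have m1E : m = 1 by apply/eqP; rewrite eq_le m1 m1'.
by move=> v; rewrite -[leRHS]mul1r -m1E.
Qed.

Theorem theorem10 (R : realType) (K N : nat) (N_gt0 : (0 < N)%N)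
    (x : 'I_N -> 'cV[R]_K) (x_neq0 : forall i : 'I_N, x i != 0)
    (T : 'M[R]_K) (T_posdef : sym_posdef T)
    (alpha0 : R) (alpha0_gt0 : 0 < alpha0) :
  (exists S : 'M[R]_K, sym_posdef S /\ solves_fixed_point x T alpha0 S) ->
  exists! S : 'M[R]_K, sym_posdef S /\ solves_fixed_point x T alpha0 S.
Proof.
case=> S [PS ES]; exists S; split=> [//|S' [PS' ES']].
(* The right-hand side depends on the solution only through the scalars [quadform (invmx S) (x i)],
   so their equality suffices. *)
rewrite ES ES'; congr (_ *: _ + _); apply: eq_bigr => i _; congr (_^-1 *: _).
have le := @fixed_point_le _ _ _ _ _ _ _ _ x_neq0 T_posdef alpha0_gt0.
have inv_le A B : sym_posdef A -> sym_posdef B ->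
    solves_fixed_point x T alpha0 A -> solves_fixed_point x T alpha0 B ->
    quadform (invmx B) (x i) <= quadform (invmx A) (x i).
  move=> PA PB EA EB; rewrite -[leRHS]mul1r; apply: quadform_inv_antitone => // v.
  by rewrite mul1r le.
by apply/eqP; rewrite eq_le !inv_le.
Qed.
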